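(* Let $\alpha,\beta\in L^\infty(\Omega,C\ell_{0,n})$ satisfy $\|\alpha\|_{L^\infty}+\|\beta\|_{L^\infty}<1/\|T_\Omega\|$, where $\|T_\Omega\|$ is the operator norm of $T_\Omega$ from $L^\infty(\Omega)$ to itself, and let $K^B_{\alpha,\beta}$, $B\in\mathcal P$, be the component-wise reproducing Vekua kernels. Then the Vekua projection $P_{\alpha,\beta}$ is given, for all $w=\sum_B w_B\,e_B\in L^2(\Omega,C\ell_{0,n})$ and $\vec x\in\Omega$, by $$P_{\alpha,\beta}[w](\vec x)=\int_\Omega\sum_{B\in\mathcal P}(-1)^{\frac{|B|(|B|+1)}{2}}\,e_B^2\,K^B_{\alpha,\beta}(\vec x,\vec y)\,w_B(\vec y)\,d\sigma_{\vec y}.$$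
   Context: $C\ell_{0,n}$ is the real Clifford algebra generated by $e_1,\dots,e_n$ (with $e_0=1$) subject to $e_ie_j+e_je_i=-2\delta_{ij}$. $\mathcal P$ is the power set of $\{1,\dots,n\}$; for $A=\{i_1<\dots<i_k\}\in\mathcal P$, $|A|=k$, $e_A=e_{i_1}\cdots e_{i_k}$ ($e_\emptyset=1$), and every $C\ell_{0,n}$-valued function is written $w=\sum_{A\in\mathcal P}w_A\,e_A$ with real-valued $w_A$. Conjugation $a\mapsto\overline a$ is the real-linear anti-automorphism with $\overline{ab}=\overline b\,\overline a$, $\overline 1=1$, $\overline{e_i}=-e_i$; $\mathrm{Sc}\,a$ is the coefficient of $1$; $|a|$ for $a\in C\ell_{0,n}$ is the Euclidean norm of the coefficient vector in $\mathbb{R}^{2^n}$. $\Omega\subset\mathbb{R}^n$ is a bounded domain with sufficiently smooth boundary. $\langle u,v\rangle_{0,L^2}=\mathrm{Sc}\int_\Omega\overline u\,v\,d\sigma$. $D=\sum_{i=1}^n e_i\partial_i$, acting from the left. $A^2_{\alpha,\beta}(\Omega,C\ell_{0,n})$ is the closed real subspace of $w\in L^2(\Omega,C\ell_{0,n})$ satisfying $Dw=\alpha\overline w+\beta w$ in $\Omega$ in the sense of distributions (pointwise values refer to the continuous representative). $P_{\alpha,\beta}$ is the orthogonal projection of $L^2(\Omega,C\ell_{0,n})$ onto $A^2_{\alpha,\beta}(\Omega,C\ell_{0,n})$ with respect to $\langle\cdot,\cdot\rangle_{0,L^2}$. The Teodorescu transform is $T_\Omega[w](\vec x)=-\int_\Omega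 E(\vec y-\vec x)w(\vec y)\,d\vec y$ with $E(\vec x)=-\dfrac{\vec x}{\sigma_n|\vec x|^n}$, $\vec x=\sum_i x_ie_i$, $\sigma_n$ the surface area of the unit sphere in $\mathbb{R}^n$. Under the stated smallness condition, for each $A\in\mathcal P$ and $\vec x\in\Omega$ the Vekua kernel $K^A_{\alpha,\beta}(\cdot,\vec x)$ is the element of $A^2_{\alpha,\beta}(\Omega,C\ell_{0,n})$ with $w_A(\vec x)=\langle K^A_{\alpha,\beta}(\cdot,\vec x),w\rangle_{0,L^2}$ for all $w\in A^2_{\alpha,\beta}(\Omega,C\ell_{0,n})$; $K^A_{\alpha,\beta}(\vec y,\vec x)$ denotes the value of $K^A_{\alpha,\beta}(\cdot,\vec x)$ at $\vec y$. *)

(* Defs.v *)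
From HB Require Import structures.
From mathcomp Require Import all_boot all_order all_algebra.
From mathcomp Require Import all_classical all_reals all_analysis.
From mathcomp Require Import measurable_realfun ess_sup_inf.
From mathcomp Require Import ring lra.

Set Implicit Arguments.
Unset Strict Implicit.
Unset Printing Implicit Defensive.

Import Order.TTheory GRing.Theory Num.Theory.
Import numFieldNormedType.Exports.

Local Open Scope ring_scope.

Section SymmetricDifference.
Variable I : finType.
Implicit Types A B C : {set I}.

Definition symd A B : {set I} := [set i | (i \in A) (+) (i \in B)]%SET.

Lemma symdA : associative symd.
Proof. by move=> A B C; apply/setP => i; rewrite !inE addbA. Qed.

Lemma symdC : commutative symd.
Proof. by move=> A B; apply/setP => i; rewrite !inE addbC. Qed.

Lemma symd0 A : symd A finset.set0 = A.
Proof. by apply/setP => i; rewrite !inE addbF. Qed.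

Lemma symdd A : symd A A = finset.set0.
Proof. by apply/setP => i; rewrite !inE addbb. Qed.

Lemma symdK A B : symd A (symd A B) = B.
Proof. by rewrite symdA symdd symdC symd0. Qed.

Lemma prod_symd (R : comNzRingType) (u : I -> R) A B :
  (forall i, u i * u i = 1) ->
  \prod_(i in symd A B) u i = (\prod_(i in A) u i) * \prod_(i in B) u i.
Proof.
move=> u2; rewrite big_mkcond [X in _ = X * _]big_mkcond [X in _ = _ * X]big_mkcond /=.
rewrite -big_split /=; apply: eq_bigr => i _; rewrite !inE.
by case: (i \in A) (i \in B) => -[]; rewrite /= ?u2 ?mul1r ?mulr1.
Qed.

End SymmetricDifference.

(* [clifford R n] is Cl_{0,n} in the basis (e_A), A ranging over the subsets of
   'I_n; the index i : 'I_n stands for i + 1 in {1, ..., n}. It is a separate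
   type because {ffun _ -> R} already carries the pointwise product. *)
Definition clifford (R : Type) (n : nat) : Type := {ffun {set 'I_n} -> R}.

HB.instance Definition _ (R : comNzRingType) n :=
  GRing.Lmodule.copy (clifford R n) {ffun {set 'I_n} -> R^o}.

Section Clifford.
Variables (R : comNzRingType) (n : nat).
Local Notation Cl := (clifford R n).
Implicit Types (A B C : {set 'I_n}) (a b c : Cl).

Definition coef a A : R := (a : {ffun _ -> _}) A.
Definition mkcl (f : {set 'I_n} -> R) : Cl := [ffun A => f A].

Lemma coefE f A : coef (mkcl f) A = f A.
Proof. by rewrite /coef ffunE. Qed.

Lemma clP a b : (forall A, coef a A = coef b A) -> a = b.
Proof. by move=> ab; apply/ffunP. Qed.

Lemma coefD a b A : coef (a + b) A = coef a A + coef b A.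
Proof. by rewrite /coef ffunE. Qed.
Lemma coefN a A : coef (- a) A = - coef a A.
Proof. by rewrite /coef ffunE. Qed.
Lemma coefZ k a A : coef (k *: a) A = k * coef a A.
Proof. by rewrite /coef ffunE. Qed.
Lemma coef0 A : coef 0 A = 0.
Proof. by rewrite /coef ffunE. Qed.

Lemma coef_sum (I : Type) (r : seq I) (P : pred I) (F : I -> Cl) A :
  coef (\sum_(i <- r | P i) F i) A = \sum_(i <- r | P i) coef (F i) A.
Proof.
by apply: (big_morph (coef^~ A)); [move=> a b; exact: coefD | exact: coef0].
Qed.

(* e_A e_B = cl_sign A B e_(A symd B): sorting contributes -1 for every pair
   (i, j) in A x B with j < i, and e_i e_i = -1 for every pair with j = i. *)
Definition cl_sign A B : R :=
  \prod_(i in A) \prod_(j in B) (-1) ^+ (j <= i)%N.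

Lemma cl_sign_sq (b : bool) : (-1) ^+ b * (-1) ^+ b = 1 :> R.
Proof. by rewrite -signr_addb addbb. Qed.

Lemma cl_sign_symdl A B C : cl_sign (symd A B) C = cl_sign A C * cl_sign B C.
Proof.
apply: prod_symd => i; rewrite -big_split /=.
by apply: big1 => j _; rewrite cl_sign_sq.
Qed.

Lemma cl_sign_symdr A B C : cl_sign A (symd B C) = cl_sign A B * cl_sign A C.
Proof.
rewrite /cl_sign -big_split /=; apply: eq_bigr => i _; apply: prod_symd => j.
exact: cl_sign_sq.
Qed.

Lemma cl_sign0l A : cl_sign finset.set0 A = 1.
Proof. by rewrite /cl_sign finset.big_set0. Qed.

Lemma cl_sign0r A : cl_sign A finset.set0 = 1.
Proof. by rewrite /cl_sign big1 // => i _; rewrite finset.big_set0. Qed.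

Definition cl_one : Cl := mkcl (fun A => (A == finset.set0)%:R).

(* The pairs (A, B) with A symd B = C are the pairs (A, A symd C). *)
Definition cl_mul a b : Cl := mkcl (fun C =>
  \sum_A coef a A * coef b (symd A C) * cl_sign A (symd A C)).

Lemma cl_mulA : associative cl_mul.
Proof.
move=> a b c; apply: clP => D; rewrite !coefE.
under eq_bigr => A _.
  rewrite coefE mulr_sumr mulr_suml.
  over.
under [RHS]eq_bigr => C _.
  rewrite coefE 2!mulr_suml.
  over.
rewrite [RHS]exchange_big /=; apply: eq_bigr => A _.
rewrite [RHS](reindex (symd A)) /=; last first.
  by exists (symd A) => B _; rewrite symdK.
apply: eq_bigr => B _; rewrite symdK.
have -> : symd B (symd A D) = symd (symd A B) D by rewrite symdA (symdC B).
have -> : cl_sign A (symd A D) = cl_sign A B * cl_sign A (symd (symd A B) D).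
  by rewrite -cl_sign_symdr (symdC A B) -symdA symdK.
rewrite cl_sign_symdl; ring.
Qed.

Lemma cl_mul1l : left_id cl_one cl_mul.
Proof.
move=> a; apply: clP => C; rewrite coefE (bigD1 finset.set0) //= big1 => [|A /negPf A0].
  by rewrite coefE eqxx symdC symd0 cl_sign0l mul1r mulr1 addr0.
by rewrite coefE A0 !mul0r.
Qed.

Lemma cl_mul1r : right_id cl_one cl_mul.
Proof.
move=> a; apply: clP => C; rewrite coefE (bigD1 C) //= big1 => [|A AC].
  by rewrite coefE symdd eqxx cl_sign0r !mulr1 addr0.
rewrite coefE; case: eqP => [A0|_]; last by rewrite mulr0 mul0r.
by move: AC; rewrite -(symd0 A) -A0 symdK eqxx.
Qed.

Lemma cl_mulDl : left_distributive cl_mul +%R.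
Proof.
move=> a b c; apply: clP => C; rewrite coefD !coefE -big_split /=.
by apply: eq_bigr => A _; rewrite coefD; ring.
Qed.

Lemma cl_mulDr : right_distributive cl_mul +%R.
Proof.
move=> a b c; apply: clP => C; rewrite coefD !coefE -big_split /=.
by apply: eq_bigr => A _; rewrite coefD; ring.
Qed.

Lemma cl_one_neq0 : cl_one != 0.
Proof.
apply/eqP => /(congr1 (coef^~ finset.set0)); rewrite coefE coef0 eqxx => /eqP.
by rewrite oner_eq0.
Qed.

HB.instance Definition _ := GRing.Zmodule_isNzRing.Build (clifford R n)
  cl_mulA cl_mul1l cl_mul1r cl_mulDl cl_mulDr cl_one_neq0.

Lemma cl_scaleAl (k : R) a b : k *: (a * b) = k *: a * b.
Proof.
apply: clP => C; rewrite coefZ !coefE mulr_sumr.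
by apply: eq_bigr => A _; rewrite coefZ; ring.
Qed.

HB.instance Definition _ :=
  GRing.LSemiModule_isLSemiAlgebra.Build R (clifford R n) cl_scaleAl.

Lemma cl_scaleAr (k : R) a b : k *: (a * b) = a * (k *: b).
Proof.
apply: clP => C; rewrite coefZ !coefE mulr_sumr.
by apply: eq_bigr => A _; rewrite coefZ; ring.
Qed.

HB.instance Definition _ :=
  GRing.LSemiAlgebra_isSemiAlgebra.Build R (clifford R n) cl_scaleAr.

Definition cle A : Cl := mkcl (fun B => (B == A)%:R).
Definition gen (i : 'I_n) : Cl := cle [set i]%SET.

(* Conjugation in coordinates; [cl_conjM], [cl_conj1] and [cl_conj_gen] below
   characterize it as the anti-automorphism with e_i |-> - e_i. *)
Definition cl_conj a : Cl :=
  mkcl (fun A => (-1) ^+ (#|A| * (#|A| + 1) %/ 2)%N * coef a A).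

Definition scalar_part a : R := coef a finset.set0.

Lemma cl_expand a : a = \sum_A coef a A *: cle A.
Proof.
apply: clP => B; rewrite coef_sum (bigD1 B) //= big1 => [|A /negPf AB].
  by rewrite coefZ coefE eqxx mulr1 addr0.
by rewrite coefZ coefE eq_sym AB mulr0.
Qed.

Lemma cle0 : cle finset.set0 = 1.
Proof. by []. Qed.

Lemma coefM a b C : coef (a * b) C =
  \sum_A coef a A * coef b (symd A C) * cl_sign A (symd A C).
Proof. exact: coefE. Qed.

Lemma cleM A B : cle A * cle B = cl_sign A B *: cle (symd A B).
Proof.
apply: clP => C; rewrite coefM coefZ (bigD1 A) //= big1 => [|D /negPf DA].
  rewrite !coefE eqxx mul1r addr0; have [->|CAB] := eqVneq C (symd A B).
    by rewrite symdK eqxx mul1r mulr1.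
  have /negPf -> : symd A C != B by apply: contra CAB => /eqP <-; rewrite symdK.
  by rewrite mul0r mulr0.
by rewrite coefE DA !mul0r.
Qed.

Lemma cl_sign11 i j : cl_sign [set i]%SET [set j]%SET = (-1) ^+ (j <= i)%N.
Proof. by rewrite /cl_sign !finset.big_set1. Qed.

Lemma gen_sq i : gen i * gen i = -1.
Proof. by rewrite cleM symdd cle0 cl_sign11 leqnn expr1 scaleN1r. Qed.

Lemma gen_anticomm i j : gen i * gen j + gen j * gen i = - ((i == j)%:R *+ 2).
Proof.
have [<-|ij] := eqVneq i j; first by rewrite gen_sq -mulr2n mulNrn.
rewrite !cleM !cl_sign11 (symdC [set j]%SET) -scalerDl mul0rn oppr0.
have /negPf neq : (i != j :> nat) by [].
by case: ltngtP neq => // _ _; rewrite ?expr1 ?expr0 ?addNr ?subrr scale0r.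
Qed.

Lemma prod_gen_sorted (s : seq 'I_n) : sorted ltn (map val s) ->
  \prod_(i <- s) gen i = cle [set i in s]%SET.
Proof.
elim: s => [_|i s IH].
  by rewrite big_nil -cle0; congr cle; apply/setP => i; rewrite !inE.
rewrite /= (path_sortedE ltn_trans) => /andP[/allP lti /IH IHs].
have ltis j : j \in s -> (i < j)%N by move=> js; apply: lti; apply: map_f.
rewrite big_cons IHs cleM.
have -> : cl_sign [set i]%SET [set j in s]%SET = 1.
  rewrite /cl_sign finset.big_set1 big1 // => j; rewrite inE => /ltis ij.
  by rewrite leqNgt ij.
rewrite scale1r; congr cle; apply/setP => j; rewrite !inE.
by case: eqVneq => // ->; apply/negP => /ltis; rewrite ltnn.
Qed.

Lemma cle_prod_gen A : cle A = \prod_(i <- enum A) gen i.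
Proof.
rewrite prod_gen_sorted ?finset.set_enum //.
apply: (@subseq_sorted _ ltn ltn_trans _ (map val (enum 'I_n))).
  by apply: map_subseq; rewrite [enum 'I_n]enumT; exact: filter_subseq.
by rewrite val_enum_ord iota_ltn_sorted.
Qed.

Lemma cl_signdd A : cl_sign A A = (-1) ^+ (#|A| * (#|A| + 1) %/ 2)%N.
Proof.
elim: {A}#|A| {-2}A (erefl #|A|) => [|k IH] A cA.
  by rewrite (finset.cards0_eq cA) cl_sign0l finset.cards0 expr0.
have /card_gt0P [i iA] : (0 < #|A|)%N by rewrite cA.
pose B := (A :\ i)%SET.
have cB : #|B| = k by move: cA; rewrite (finset.cardsD1 i) iA => -[].
rewrite cA; have -> : A = symd [set i]%SET B.
  apply/setP => j; rewrite !inE; have [->|] := eqVneq j i; first by rewrite iA.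
  by [].
rewrite cl_sign_symdl !cl_sign_symdr cl_sign11 leqnn (IH B cB).
have -> : (k.+1 * (k.+1 + 1) %/ 2 = k.+1 + k * (k + 1) %/ 2)%N.
  by rewrite -divnMDl //; congr (_ %/ _)%N; ring.
have cross : cl_sign [set i]%SET B * cl_sign B [set i]%SET = (-1) ^+ k.
  rewrite /cl_sign finset.big_set1 -big_split /= -cB -prodr_const.
  apply: eq_bigr => j; rewrite !inE => /andP[ji _]; rewrite finset.big_set1.
  have : (j != i :> nat) by [].
  by case: ltngtP => // _ _; rewrite ?expr1 ?expr0 ?mulr1 ?mul1r.
by rewrite exprD exprS -cross cB expr1; ring.
Qed.

Lemma cl_conjM a b : cl_conj (a * b) = cl_conj b * cl_conj a.
Proof.
apply: clP => C; rewrite coefE !coefM mulr_sumr.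
rewrite [RHS](reindex (symd C)) /=; last first.
  by exists (symd C) => A _; rewrite symdK.
apply: eq_bigr => A _; rewrite !coefE -!cl_signdd (symdC C A).
set B := symd A C; have -> : symd B C = A by rewrite -symdA symdd symd0.
have : C = symd A B by rewrite symdK.
move: {+}B => {}B ->; rewrite !cl_sign_symdl !cl_sign_symdr.
have sq : cl_sign A B * cl_sign A B = 1.
  rewrite /cl_sign -big_split big1 //= => i _; rewrite -big_split big1 //= => j _.
  exact: cl_sign_sq.
transitivity (cl_sign A A * cl_sign B B * cl_sign B A * (coef a A * coef b B)
  * (cl_sign A B * cl_sign A B)); first by ring.
by rewrite sq; ring.
Qed.

Lemma coef_conj a A :
  coef (cl_conj a) A = (-1) ^+ (#|A| * (#|A| + 1) %/ 2)%N * coef a A.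
Proof. exact: coefE. Qed.

Lemma cl_conjD a b : cl_conj (a + b) = cl_conj a + cl_conj b.
Proof. by apply: clP => A; rewrite [RHS]coefD !coef_conj coefD mulrDr. Qed.

Lemma cl_conjZ k a : cl_conj (k *: a) = k *: cl_conj a.
Proof. by apply: clP => A; rewrite [RHS]coefZ !coef_conj coefZ mulrCA. Qed.

Lemma cl_conj1 : cl_conj 1 = 1.
Proof.
apply: clP => A; rewrite -cle0 !coefE.
by case: eqP => [->|_]; rewrite ?mulr0 // finset.cards0 expr0 mulr1.
Qed.

Lemma cl_conj_gen i : cl_conj (gen i) = - gen i.
Proof.
apply: clP => A; rewrite coefN !coefE.
by case: eqP => [->|_]; rewrite ?mulr0 ?oppr0 // finset.cards1 expr1 mulr1.
Qed.

End Clifford.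

Local Open Scope classical_set_scope.

Section BorelRV.
Variables (R : realType) (n : nat).

Definition borel_rV : set (set 'rV[R]_n) := <<s [set A | open A] >>.

Let borel0 : borel_rV set0.
Proof. exact: sigma_algebra0. Qed.

Let borelC A : borel_rV A -> borel_rV (~` A).
Proof. exact: sigma_algebraC. Qed.

Let borel_bigcup (F : (set 'rV[R]_n)^nat) :
  (forall i, borel_rV (F i)) -> borel_rV (\bigcup_i F i).
Proof. exact: sigma_algebra_bigcup. Qed.

HB.instance Definition _ := @isMeasurable.Build default_measure_display
  'rV[R]_n borel_rV borel0 borelC borel_bigcup.

Lemma open_measurable_rV (A : set 'rV[R]_n) : open A -> measurable A.
Proof. exact: sub_sigma_algebra. Qed.

End BorelRV.

Lemma continuous_measurable_rV (R : realType) n m (f : 'rV[R]_n -> 'rV[R]_m) :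
  continuous f -> measurable_fun setT f.
Proof.
move=> /continuousP cf.
apply: (measurability [set A : set 'rV[R]_m | open A]) => // _ [B oB <-].
by rewrite setTI; apply: open_measurable_rV; exact: cf.
Qed.

Lemma coord_measurable_rV (R : realType) n (i : 'I_n) :
  measurable_fun setT (fun v : 'rV[R]_n => v ord0 i : measurableTypeR R).
Proof.
apply: (measurability (@RGenOpens.G R)); first exact: RGenOpens.measurableE.
move=> _ [_ [x [y ->]] <-]; rewrite setTI; apply: open_measurable_rV.
have /continuousP := @coord_continuous R 1 n ord0 i; apply.
exact: interval_open.
Qed.

Lemma measurable_fun_rV (R : realType) n d (T : measurableType d)
    (f : T -> 'rV[R]_n) :
  (forall i, measurable_fun setT (fun t => f t ord0 i : measurableTypeR R)) ->
  measurable_fun setT f.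
Proof.
move=> mf; apply: (measurability [set A : set 'rV[R]_n | open A]) => //.
move=> _ [U oU <-]; rewrite setTI.
pose box (pq : 'rV[rat]_n * 'rV[rat]_n) : set 'rV[R]_n :=
  [set v | forall i, ratr (pq.1 ord0 i) < v ord0 i < ratr (pq.2 ord0 i)].
pose F pq := if pselect (box pq `<=` U) then f @^-1` box pq else set0.
have -> : f @^-1` U = \bigcup_pq F pq.
  apply/seteqP; split => [t /= Uft|t [pq _]]; last first.
    by rewrite /F; case: pselect => // boxU /boxU.
  have /nbhs_ballP[e /= e0 beU] : nbhs (f t) U by exact: open_nbhs_nbhs.
  have /choice[p pP] i : exists q : rat, f t ord0 i - e < ratr q < f t ord0 i.
    have /rat_in_itvoo[q qi] : f t ord0 i - e < f t ord0 i by rewrite gtrBl.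
    by exists q; move: qi; rewrite in_itv.
  have /choice[q qP] i : exists q : rat, f t ord0 i < ratr q < f t ord0 i + e.
    have /rat_in_itvoo[q qi] : f t ord0 i < f t ord0 i + e by rewrite ltrDl.
    by exists q; move: qi; rewrite in_itv.
  exists (\row_i p i, \row_i q i) => //; rewrite /F; case: pselect => [?|nsub].
    by move=> i /=; rewrite !mxE; case/andP: (pP i) (qP i) => _ -> /andP[->].
  case: nsub => v bv; apply: beU; split => // j i; rewrite (ord1 j).
  have := bv i; rewrite /= !mxE => /andP[pv vq].
  have /andP[pi1 _] := pP i; have /andP[_ qi2] := qP i.
  rewrite /ball /= ltr_norml; apply/andP; split; lra.
apply: countable_bigcupT_measurable => [|pq]; first exact: countableP.
rewrite /F; case: pselect => [boxU|nsub] /=; last exact: measurable0.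
have -> : f @^-1` box pq = \bigcap_i
    ((fun t => f t ord0 i) @^-1` `]ratr (pq.1 ord0 i), ratr (pq.2 ord0 i)[).
  apply/seteqP; split => t /= ft i => [_|]; first by rewrite /= in_itv; exact: ft.
  by have := ft i I; rewrite /= in_itv.
apply: fin_bigcap_measurable => // i _.
by rewrite -[X in measurable X]setTI; apply: mf => //; exact: measurable_itv.
Qed.

Section ConsRV.
Variables (R : realType) (n : nat).

Definition cons_rV (p : measurableTypeR R * 'rV[R]_n) : 'rV[R]_n.+1 :=
  \row_i (if unlift ord0 i is Some j then p.2 ord0 j else p.1).

Definition uncons_rV (v : 'rV[R]_n.+1) : measurableTypeR R * 'rV[R]_n :=
  (v ord0 ord0, \row_j v ord0 (lift ord0 j)).

Lemma uncons_rVK : cancel uncons_rV cons_rV.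
Proof.
move=> v; apply/rowP => i; rewrite mxE /=.
by case: unliftP => [j ->|->]; rewrite ?mxE.
Qed.

Lemma cons_rVK : cancel cons_rV uncons_rV.
Proof.
move=> [x v]; congr pair; first by rewrite mxE unlift_none.
by apply/rowP => j; rewrite !mxE liftK.
Qed.

Lemma measurable_uncons_rV : measurable_fun setT uncons_rV.
Proof.
apply: measurable_fun_pair; first exact: coord_measurable_rV.
apply: measurable_fun_rV => i.
by under eq_fun do rewrite mxE; exact: coord_measurable_rV.
Qed.

Lemma measurable_cons_rV : measurable_fun setT cons_rV.
Proof.
apply: measurable_fun_rV => i; under eq_fun do rewrite mxE.
case: (unlift ord0 i) => [j|]; last exact: measurable_fst.
exact: (measurableT_comp (coord_measurable_rV j) measurable_snd).
Qed.

End ConsRV.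

Section LebesgueStep.
Local Open Scope ereal_scope.
Variables (R : realType) (n : nat).
Variable mu : {sigma_finite_measure set 'rV[R]_n -> \bar R}.

Definition lebesgue_step : set 'rV[R]_n.+1 -> \bar R :=
  pushforward (@lebesgue_measure R \x mu) (@cons_rV R n).

Let measurable_preimage_cons A :
  measurable A -> measurable (@cons_rV R n @^-1` A).
Proof.
move=> mA; rewrite -[X in measurable X]setTI.
exact: measurable_cons_rV.
Qed.

Let lebesgue_step0 : lebesgue_step set0 = 0.
Proof. by rewrite /lebesgue_step /pushforward preimage_set0 measure0. Qed.

Let lebesgue_step_ge0 A : 0 <= lebesgue_step A.
Proof. by rewrite /lebesgue_step /pushforward measure_ge0. Qed.

Let lebesgue_step_sigma_additive : semi_sigma_additive lebesgue_step.
Proof.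
move=> F mF tF mUF; rewrite /lebesgue_step /pushforward preimage_bigcup.
apply: measure_semi_sigma_additive.
- by move=> k; exact: measurable_preimage_cons.
- apply/trivIsetP => /= i j _ _ ij; rewrite -preimage_setI.
  by move/trivIsetP : tF => /(_ _ _ _ _ ij) ->//; rewrite preimage_set0.
- by rewrite -preimage_bigcup; exact: measurable_preimage_cons.
Qed.

HB.instance Definition _ := isMeasure.Build _ _ _ lebesgue_step
  lebesgue_step0 lebesgue_step_ge0 lebesgue_step_sigma_additive.

Let lebesgue_step_sigma_finite : sigma_finite setT lebesgue_step.
Proof.
have /sigma_finiteP[F [FT ndF Ffin]] := sigma_finiteT (@lebesgue_measure R).
have /sigma_finiteP[G [GT ndG Gfin]] := sigma_finiteT mu.
exists (fun k => @uncons_rV R n @^-1` (F k `*` G k)).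
  rewrite -preimage_bigcup (_ : \bigcup_k _ = setT) ?preimage_setT //.
  apply/seteqP; split=> // -[x y] _.
  have [k _ Fkx] : (\bigcup_k F k) x by rewrite -FT.
  have [l _ Gly] : (\bigcup_k G k) y by rewrite -GT.
  exists (maxn k l) => //; split => /=.
    by move: x Fkx; exact/subsetPset/ndF/leq_maxl.
  by move: y Gly; exact/subsetPset/ndG/leq_maxr.
move=> k; have [mF Fk] := Ffin k; have [mG Gk] := Gfin k.
have mFG : measurable (F k `*` G k) by exact: measurableX.
split.
  rewrite -[X in measurable X]setTI.
  exact: measurable_uncons_rV.
rewrite /lebesgue_step /pushforward -comp_preimage.
rewrite (_ : _ \o _ = id) ?preimage_id; last first.
  by apply/funext => p; exact: cons_rVK.
by rewrite product_measure1E// lte_mul_pinfty// ge0_fin_numE.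
Qed.

HB.instance Definition _ :=
  Measure_isSigmaFinite.Build _ _ _ lebesgue_step lebesgue_step_sigma_finite.

End LebesgueStep.

Section Lebesgue0.
Variable R : realType.
Definition lebesgue_zero : set 'rV[R]_0 -> \bar R := dirac (0 : 'rV[R]_0).
HB.instance Definition _ := SigmaFiniteMeasure.copy lebesgue_zero (dirac (0 : 'rV[R]_0)).
End Lebesgue0.

(* Iterated product of the one-dimensional Lebesgue measure; see
   [lebesgue_rV_box] for its value on boxes. *)
Fixpoint lebesgue_rV (R : realType) (n : nat) :
    {sigma_finite_measure set 'rV[R]_n -> \bar R} :=
  match n with
  | 0 => @lebesgue_zero R
  | m.+1 => lebesgue_step (lebesgue_rV R m)
  end.

Lemma lebesgue_rV_box (R : realType) (n : nat) (a b : 'rV[R]_n) :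
  (forall i, a ord0 i <= b ord0 i) ->
  lebesgue_rV R n [set v | forall i, a ord0 i <= v ord0 i <= b ord0 i] =
  (\prod_i (b ord0 i - a ord0 i))%:E.
Proof.
elim: n a b => [|n IH] a b ab.
  by rewrite big_ord0 /= /lebesgue_zero diracE mem_set // => -[].
rewrite big_ord_recl EFinM /= /lebesgue_step /pushforward.
pose t (v : 'rV[R]_n.+1) : 'rV[R]_n := \row_j v ord0 (lift ord0 j).
have -> : @cons_rV R n @^-1` [set v : 'rV_n.+1 | forall i, a ord0 i <= v ord0 i <= b ord0 i] =
    (`[a ord0 ord0, b ord0 ord0]%classic : set (measurableTypeR R)) `*`
    [set v : 'rV_n | forall i, t a ord0 i <= v ord0 i <= t b ord0 i].
  apply/seteqP; split => [[x v] /= xv|[x v] /= [xab vab] i].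
    split=> [|i]; first by have := xv ord0; rewrite !mxE unlift_none in_itv.
    by have := xv (lift ord0 i); rewrite !mxE liftK.
  by rewrite !mxE; case: unliftP => [j ->|->] //=; have := vab j; rewrite !mxE.
rewrite product_measure1E; [|exact: measurable_itv|].
- rewrite IH => [|i]; last by rewrite !mxE.
  congr (_ * _)%E; last first.
    by congr EFin; apply: eq_bigr => i _; rewrite !mxE.
  rewrite [LHS](lebesgue_measure_itv `[a ord0 ord0, b ord0 ord0]%R) /= lte_fin EFinB.
  by case: ltP => //; rewrite le_eqVlt ltNge ab orbF => /eqP ->; rewrite subee.
- rewrite (_ : [set v : 'rV_n | _] = \bigcap_i ((fun v : 'rV[R]_n => v ord0 i) @^-1`
    `[t a ord0 i, t b ord0 i])).
    apply: fin_bigcap_measurable => // i _; rewrite -[X in measurable X]setTI.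
    by apply: coord_measurable_rV => //; exact: measurable_itv.
  apply/seteqP; split => v /= vab i => [_|]; first by rewrite /= in_itv; exact: vab.
  by have := vab i I; rewrite /= in_itv.
Qed.

Section Vekua.
Variables (R : realType) (n : nat).
Local Notation E := 'rV[R]_n.
Local Notation Cl := (clifford R n).
Local Notation mu := (lebesgue_rV R n).
Implicit Types (Omega : set E) (u v w : E -> Cl) (phi : E -> R).

(* The library norm on 'rV[R]_n is the sup norm; it has the same open and
   bounded sets as this one. *)
Definition euclid_norm (x : E) : R := Num.sqrt (\sum_i x ord0 i ^+ 2).

Definition cl_norm (a : Cl) : R := Num.sqrt (\sum_A coef a A ^+ 2).

Definition cl_vec (x : E) : Cl := \sum_i x ord0 i *: gen R i.

Definition basis_vec (i : 'I_n) : E := delta_mx ord0 i.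

Definition partial (i : 'I_n) phi : E -> R := 'D_(basis_vec i) phi.

Definition bounded_domain Omega : Prop :=
  [/\ open Omega, connected Omega, Omega !=set0 & bounded_set Omega].

(* Near each boundary point, Omega is a sublevel set {rho < 0} of a C^1
   function with nonvanishing gradient. *)
Definition C1_boundary Omega : Prop :=
  forall x, (closure Omega `\` Omega) x ->
  exists (U : set E) (rho : E -> R),
    [/\ open U, U x,
        forall y i, U y -> derivable rho y (basis_vec i) /\
          {for y, continuous (partial i rho)},
        forall y, U y -> exists i, partial i rho y != 0 &
        Omega `&` U = [set y | U y /\ rho y < 0]].

Definition cl_measurable Omega w : Prop :=
  forall A, measurable_fun Omega (fun x => coef (w x) A).

Definition cl_continuous Omega w : Prop :=
  forall A x, Omega x -> {for x, continuous (fun y => coef (w y) A)}.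

Definition cl_integrable Omega w : Prop :=
  forall A, mu.-integrable Omega (fun x => (coef (w x) A)%:E).

Definition cl_integral Omega w : Cl :=
  mkcl (fun A => \int[mu]_(x in Omega) coef (w x) A).

Definition L2 Omega w : Prop :=
  cl_measurable Omega w /\
  (\int[mu]_(x in Omega) (cl_norm (w x) ^+ 2)%:E < +oo)%E.

Definition inner_L2 Omega u v : R :=
  scalar_part (cl_integral Omega (fun x => cl_conj (u x) * v x)).

Definition Linf_norm Omega w : \bar R :=
  ess_sup mu (fun x => (((cl_norm \o w) \_ Omega) x)%:E).

Definition Linf Omega w : Prop :=
  cl_measurable Omega w /\ (Linf_norm Omega w < +oo)%E.

(* Surface area from polar coordinates: n times the volume of the unit ball. *)
Definition sphere_area : R :=
  n%:R * fine (mu [set x | euclid_norm x <= 1]).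

Definition cauchy_kernel (x : E) : Cl :=
  - ((sphere_area * euclid_norm x ^+ n)^-1 *: cl_vec x).

Definition teodorescu Omega w (x : E) : Cl :=
  - cl_integral Omega (fun y => cauchy_kernel (y - x) * w y).

Definition teodorescu_norm Omega : \bar R :=
  ereal_sup [set Linf_norm Omega (teodorescu Omega w) |
    w in [set w | Linf Omega w /\ (Linf_norm Omega w <= 1)%E]].

Definition smooth phi : Prop :=
  forall s : seq 'I_n, let g := foldr partial phi s in
    continuous g /\ forall x i, derivable g x (basis_vec i).

Definition test_function Omega phi : Prop :=
  let supp := closure [set x | phi x != 0] in
  [/\ smooth phi, compact supp & supp `<=` Omega].

(* D w = alpha (conj w) + beta w in the sense of distributions, where
   D = sum_i e_i d_i acts from the left. *)
Definition vekua_weak Omega (alpha beta w : E -> Cl) : Prop :=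
  forall phi, test_function Omega phi ->
    - cl_integral Omega (fun x => \sum_i partial i phi x *: (gen R i * w x)) =
    cl_integral Omega (fun x =>
      phi x *: (alpha x * cl_conj (w x) + beta x * w x)).

(* Functions stand for their a.e. classes in the definition of A^2. *)
Definition bergman_vekua Omega (alpha beta w : E -> Cl) : Prop :=
  L2 Omega w /\ vekua_weak Omega alpha beta w.

(* k is the continuous representative of K^A_{alpha,beta}(., x). *)
Definition vekua_kernel Omega alpha beta (A : {set 'I_n}) (x : E) k : Prop :=
  [/\ bergman_vekua Omega alpha beta k, cl_continuous Omega k &
    forall w, bergman_vekua Omega alpha beta w -> cl_continuous Omega w ->
      coef (w x) A = inner_L2 Omega k w].

(* P is the orthogonal projection of L^2(Omega) onto A^2_{alpha,beta}(Omega),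
   with P w chosen to be the continuous representative. *)
Definition vekua_projection Omega alpha beta (P : (E -> Cl) -> E -> Cl) : Prop :=
  forall w, L2 Omega w ->
    [/\ bergman_vekua Omega alpha beta (P w), cl_continuous Omega (P w) &
      forall v, bergman_vekua Omega alpha beta v ->
        inner_L2 Omega v (fun x => w x - P w x) = 0].

End Vekua.

(* Main.v *)
(* The factor (-1)^(|B|(|B|+1)/2) e_B^2 equals 1, and Sc (conj a * b) is the
   Euclidean pairing of coefficient vectors. Testing K^A(., x) and K^B(., y)
   against each other gives K^B_A(x, y) = K^A_B(y, x), so the A-component of the
   integral is <K^A(., x), w>. Since w - P w is orthogonal to K^A(., x), this is
   <K^A(., x), P w>, which reproduces the A-component of P w at x. *)
Require Import Defs.
From HB Require Import structures.
From mathcomp Require Import all_boot all_order all_algebra.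
From mathcomp Require Import all_classical all_reals all_analysis.
From mathcomp Require Import measurable_realfun lra.

Set Implicit Arguments.
Unset Strict Implicit.
Unset Printing Implicit Defensive.

Import Order.TTheory GRing.Theory Num.Theory.
Import numFieldNormedType.Exports.

Local Open Scope ring_scope.
Local Open Scope classical_set_scope.

Lemma cl_sign_mulself (R : comNzRingType) n (A B : {set 'I_n}) :
  cl_sign R A B * cl_sign R A B = 1.
Proof. by rewrite -cl_sign_symdr symdd cl_sign0r. Qed.

(** In the coefficient of [1], index [A] meets only itself, since [symd A B] is empty exactly when
    [A = B]. The sign from conjugation and the sign of [e_A^2] are both [cl_sign A A], so their
    product is 1. *)
Lemma scalar_part_conjM (R : comNzRingType) n (a b : clifford R n) :
  scalar_part (cl_conj a * b) = \sum_A coef a A * coef b A.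
Proof.
rewrite /scalar_part Defs.coefM; apply: eq_bigr => A _.
rewrite symd0 coef_conj -cl_signdd.
by rewrite mulrAC [X in X * _]mulrAC cl_sign_mulself mul1r.
Qed.

Lemma sign_cle_sq (R : comNzRingType) n (B : {set 'I_n}) :
  (-1) ^+ (#|B| * (#|B| + 1) %/ 2)%N * cle R B ^+ 2 = 1.
Proof.
rewrite expr2 cleM symdd cle0 cl_signdd -cl_scaleAr mulr1.
(* This sign is a power of -1 taken in the Clifford algebra; written as a real scalar, it can be
   multiplied with the real sign of [e_B^2]. *)
have -> k : (-1 : clifford R n) ^+ k = ((-1) ^+ k)%:A.
  elim: k => [|k IH]; first by rewrite !expr0 scale1r.
  by rewrite !exprS IH !mulN1r scaleNr.
by rewrite scalerA -exprMn mulrNN mulr1 expr1n scale1r.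
Qed.

Section L2Pairing.
Variables (R : realType) (n : nat) (Omega : set 'rV[R]_n).
Hypothesis mOmega : measurable Omega.
Implicit Types u v : 'rV[R]_n -> clifford R n.
Local Notation mu := (lebesgue_rV R n).

Lemma inner_L2E u v :
  inner_L2 Omega u v =
  \int[mu]_(x in Omega) \sum_A coef (u x) A * coef (v x) A.
Proof.
rewrite /inner_L2 /scalar_part Defs.coefE.
by apply: eq_Rintegral => x _; rewrite -scalar_part_conjM.
Qed.

Lemma inner_L2C u v : inner_L2 Omega u v = inner_L2 Omega v u.
Proof.
rewrite !inner_L2E; apply: eq_Rintegral => x _.
by apply: eq_bigr => A _; rewrite mulrC.
Qed.

Lemma cl_norm_sq (a : clifford R n) : cl_norm a ^+ 2 = \sum_A coef a A ^+ 2.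
Proof. by rewrite sqr_sqrtr // sumr_ge0 // => A _; exact: sqr_ge0. Qed.

Lemma coef_sq_le (a : clifford R n) A : coef a A ^+ 2 <= cl_norm a ^+ 2.
Proof.
by rewrite cl_norm_sq (bigD1 A) //= lerDl sumr_ge0 // => B _; exact: sqr_ge0.
Qed.

Lemma L2_integrable_sq u :
  L2 Omega u -> mu.-integrable Omega (fun x => (cl_norm (u x) ^+ 2)%:E).
Proof.
move=> [mu_u fin_u]; apply/integrableP; split.
  apply/measurable_EFinP.
  under eq_fun do rewrite cl_norm_sq.
  by apply: measurable_sum => A; exact: measurable_funX.
under eq_integral do rewrite gee0_abs ?lee_fin ?sqr_ge0 //.
exact: fin_u.
Qed.

Lemma L2_integrable_coefM u v A B : L2 Omega u -> L2 Omega v ->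
  mu.-integrable Omega (fun x => (coef (u x) A * coef (v x) B)%:E).
Proof.
move=> Lu Lv.
(* The dominating function is [|u|^2 + |v|^2]. *)
apply: le_integrable
  (integrableD mOmega (L2_integrable_sq Lu) (L2_integrable_sq Lv)) => //.
  apply/measurable_EFinP; apply: measurable_funM; first exact: Lu.1.
  exact: Lv.1.
move=> x _ /=; rewrite lee_fin normrM [leRHS]ger0_norm ?addr_ge0 ?sqr_ge0 //.
apply: le_trans (lerD (coef_sq_le (u x) A) (coef_sq_le (v x) B)).
(* With the squares written through absolute values, the goal becomes [|a| |b| <= |a|^2 + |b|^2]. *)
rewrite -(real_normK (num_real (coef (u x) A))).
rewrite -(real_normK (num_real (coef (v x) B))).
nra.
Qed.

Lemma L2_integrable_pairing u v : L2 Omega u -> L2 Omega v ->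
  mu.-integrable Omega (fun x => (\sum_A coef (u x) A * coef (v x) A)%:E).
Proof.
move=> Lu Lv.
under eq_fun do rewrite -sumEFin.
by apply: integrable_sum => // A _; exact: L2_integrable_coefM.
Qed.

(** Membership in [L2] makes both pairings integrable, which the subtraction of integrals
    requires. *)
Lemma inner_L2Br u v w : L2 Omega u -> L2 Omega v -> L2 Omega w ->
  inner_L2 Omega u (fun x => v x - w x) =
  inner_L2 Omega u v - inner_L2 Omega u w.
Proof.
move=> Lu Lv Lw; rewrite !inner_L2E -RintegralB //; try exact: L2_integrable_pairing.
apply: eq_Rintegral => x _; rewrite -sumrB; apply: eq_bigr => A _.
by rewrite Defs.coefD Defs.coefN mulrDr mulrN.
Qed.

End L2Pairing.

Theorem proposition19 (R : realType) (n : nat) (Omega : set 'rV[R]_n)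
    (alpha beta : 'rV[R]_n -> clifford R n)
    (K : {set 'I_n} -> 'rV[R]_n -> 'rV[R]_n -> clifford R n)
    (P : ('rV[R]_n -> clifford R n) -> 'rV[R]_n -> clifford R n) :
  (0 < n)%N ->
  bounded_domain Omega -> C1_boundary Omega ->
  Linf Omega alpha -> Linf Omega beta ->
  (Linf_norm Omega alpha + Linf_norm Omega beta
    < (teodorescu_norm Omega)^-1)%E ->
  (forall (A : {set 'I_n}) (x : 'rV[R]_n), Omega x ->
    vekua_kernel Omega alpha beta A x (fun y => K A y x)) ->
  vekua_projection Omega alpha beta P ->
  forall w : 'rV[R]_n -> clifford R n, L2 Omega w ->
  forall x : 'rV[R]_n, Omega x ->
  let F y := \sum_(B : {set 'I_n})
    (-1) ^+ (#|B| * (#|B| + 1) %/ 2)%N * cle R B ^+ 2 * K B x y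
      * (coef (w y) B)%:A in
  cl_integrable Omega F /\ P w x = cl_integral Omega F.
Proof.
move=> _ [oOmega _ _ _] _ _ _ _ repK projP w Lw x Ox F.
have mOmega : measurable Omega by exact: open_measurable_rV.
have KL2 A z : Omega z -> L2 Omega (fun y => K A y z).
  by move=> /(repK A)[[]].
have symK A B y : Omega y -> coef (K B x y) A = coef (K A y x) B.
  move=> Oy; have [bKA cKA repA] := repK A x Ox.
  have [bKB cKB repB] := repK B y Oy.
  by rewrite (repA _ bKB cKB) (repB _ bKA cKA) inner_L2C.
(* The symmetry of the kernels is available only for [y] in [Omega], which suffices under an
   integral over [Omega]. The real factor [(coef (w y) B)%:A] is central and comes out as a
   scalar. *)
have FE A y : Omega y ->
    coef (F y) A = \sum_B coef (K A y x) B * coef (w y) B.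
  move=> Oy; rewrite Defs.coef_sum; apply: eq_bigr => B _.
  by rewrite sign_cle_sq mul1r -cl_scaleAr mulr1 Defs.coefZ symK // mulrC.
split=> [A|].
  apply: eq_integrable (L2_integrable_pairing mOmega (KL2 A x Ox) Lw) => //.
  by move=> y; rewrite inE => Oy; rewrite FE.
apply: clP => A; have [bK cK repA] := repK A x Ox.
have [bP cP orthP] := projP w Lw.
have LP : L2 Omega (P w) by case: bP.
(* [P w] is the continuous representative, so its value at the given point [x] is reproduced, not
   merely its value almost everywhere. *)
rewrite (repA _ bP cP) Defs.coefE.
have /eqP := orthP _ bK; rewrite inner_L2Br // ?subr_eq0; last exact: KL2.
move=> /eqP <-; rewrite inner_L2E; apply: eq_Rintegral => y.
by rewrite inE => Oy; rewrite FE.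
Qed.
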